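(* Let $\mathcal{M}=(X,\leq,(R_i)_{i\le n},(S_j)_{j\le m},V)$ and $\mathcal{M}'=(X',\leq',(R'_i),(S'_j),V')$ be strictly condensed $\mathsf{Bi\text{-}int}_{n,m}$-models such that all relations $\leq,R_i,S_j,\leq',R'_i,S'_j$ are image-compact and additionally $\leq$ and $\leq'$ are pre-image-compact. Then for all $x\in X$, $x'\in X'$: $x$ and $x'$ are $\mathsf{Bi\text{-}int}_{n,m}$-bisimilar if and only if they satisfy exactly the same $\mathsf{Bi\text{-}int}_{n,m}$-formulae.
   Context: For relations $Z,Z'$ write $x(Z\circ Z')y$ iff there is $u$ with $xZu$, $uZ'y$; $Z[x]=\{y\mid xZy\}$, $Z^{-1}[x]=\{y\mid yZx\}$. $\mathsf{Bi\text{-}int}_{n,m}$: $\phi::=\top\mid\bot\mid p\mid\phi\wedge\phi\mid\phi\vee\phi\mid\phi\to\phi\mid\phi\,{-\!\!<}\,\phi\mid\Box_i\phi\mid\Diamond_j\phi$ ($1\le i\le n$, $1\le j\le m$, $p\in\mathrm{Prop}$). A $\mathsf{Bi\text{-}int}_{n,m}$-model is $(X,\leq,R_1,\dots,R_n,S_1,\dots,S_m,V)$ with $\leq$ a preorder, $({\leq}\circ R_i)\subseteq(R_i\circ{\leq})$, $({\geq}\circ S_j)\subseteq(S_j\circ{\geq})$, $V$ mapping variables to upsets; strictly condensed means $({\leq}\circ R_i\circ{\leq})\subseteq R_i$ and $({\geq}\circ S_j\circ{\geq})\subseteq S_j$ for all $i,j$. Truth: $x\Vdash p$ iff $x\in V(p)$;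 $\top,\bot,\wedge,\vee$ as usual; $x\Vdash\phi\to\psi$ iff for all $y\geq x$, $y\Vdash\phi$ implies $y\Vdash\psi$; $x\Vdash\phi\,{-\!\!<}\,\psi$ iff some $y\leq x$ has $y\Vdash\phi,y\not\Vdash\psi$; $x\Vdash\Box_i\phi$ iff all $y$ with $xR_iy$ satisfy $\phi$; $x\Vdash\Diamond_j\phi$ iff some $y$ with $xS_jy$ satisfies $\phi$. For upsets: $a\Rightarrow b=\{x\mid\forall y\geq x(y\in a\Rightarrow y\in b)\}$, $a\ominus b=\{x\mid\exists y\leq x, y\in a,y\notin b\}$, $\boxminus_i a=\{x\mid R_i[x]\subseteq a\}$, $\Diamond_j a=\{x\mid\exists y\in a,\ xS_jy\}$. A relation $Z$ of the model is image-compact (resp. pre-image-compact) if there is a collection $A$ of upsets containing $\emptyset,X$, all $V(p)$, closed under finite unions, finite intersections, $\Rightarrow$, $\ominus$, all $\boxminus_i$ and all $\Diamond_j$, such that $Z[x]$ (resp. $Z^{-1}[x]$) is compact for all $x$ in the topology generated by the subbase $A\cup\{X\setminus a\mid a\in A\}$. A $\mathsf{Bi\text{-}int}_{n,m}$-bisimulation is $B\subseteq X\times X'$ such that for all $(x,x')\in B$: $x\in V(p)$ iff $x'\in V'(p)$; the forth/back conditions hold for $\leq$ (if $x\leq y$ there is $y'$ with $x'\leq'y'$, $yBy'$, and conversely), for $\geq$ (if $y\leq x$ there is $y'\leq'x'$ with $yBy'$, and conversely), and for each $R_i$ and each $S_j$ (if $xZy$ there is $y'$ with $x'Z'y'$,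 $yBy'$; if $x'Z'y'$ there is $y$ with $xZy$, $yBy'$). States are bisimilar if some bisimulation contains the pair. *)

(* Defs.v *)
From HB Require Import structures.
From mathcomp Require Import all_boot all_order.
From mathcomp Require Import all_classical topology.

Set Implicit Arguments.
Unset Strict Implicit.
Unset Printing Implicit Defensive.

Local Open Scope classical_set_scope.

Definition rcomp (X Y W : Type) (Z : X -> Y -> Prop) (Z' : Y -> W -> Prop)
  (x : X) (y : W) : Prop := exists u, Z x u /\ Z' u y.

Definition rsub (X Y : Type) (Z Z' : X -> Y -> Prop) : Prop :=
  forall x y, Z x y -> Z' x y.

Definition rinv (X Y : Type) (Z : X -> Y -> Prop) (y : Y) (x : X) : Prop := Z x y.

Definition rimage (X Y : Type) (Z : X -> Y -> Prop) (x : X) : set Y :=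
  [set y | Z x y].

Definition rpreimage (X Y : Type) (Z : X -> Y -> Prop) (y : Y) : set X :=
  [set x | Z x y].

Definition is_upset (X : Type) (le : X -> X -> Prop) (a : set X) : Prop :=
  forall x y, le x y -> a x -> a y.

(* Indices 1 <= i <= n of the modalities are represented by 'I_n. *)
Inductive formula (n m : nat) (P : Type) : Type :=
| Top
| Bot
| Var of P
| And of formula n m P & formula n m P
| Or of formula n m P & formula n m P
| Imp of formula n m P & formula n m P
| Sub of formula n m P & formula n m P
| Box of 'I_n & formula n m P
| Dia of 'I_m & formula n m P.

Record model (n m : nat) (P : Type) : Type := Model {
  world :> Type;
  mle : world -> world -> Prop;
  mR : 'I_n -> world -> world -> Prop;
  mS : 'I_m -> world -> world -> Prop;
  mV : P -> set world;
  mle_refl : forall x, mle x x;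
  mle_trans : forall x y z, mle x y -> mle y z -> mle x z;
  mR_le : forall i, rsub (rcomp mle (mR i)) (rcomp (mR i) mle);
  mS_ge : forall j, rsub (rcomp (rinv mle) (mS j)) (rcomp (mS j) (rinv mle));
  mV_upset : forall p, is_upset mle (mV p)
}.

Arguments mle {n m P}.
Arguments mR {n m P}.
Arguments mS {n m P}.
Arguments mV {n m P}.

Definition strictly_condensed (n m : nat) (P : Type) (M : model n m P) : Prop :=
  (forall i, rsub (rcomp (rcomp (mle M) (mR M i)) (mle M)) (mR M i)) /\
  (forall j, rsub (rcomp (rcomp (rinv (mle M)) (mS M j)) (rinv (mle M))) (mS M j)).

Fixpoint sat (n m : nat) (P : Type) (M : model n m P) (x : M)
    (phi : formula n m P) : Prop :=
  match phi with
  | Top => True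
  | Bot => False
  | Var p => mV M p x
  | And phi psi => sat x phi /\ sat x psi
  | Or phi psi => sat x phi \/ sat x psi
  | Imp phi psi => forall y, mle M x y -> sat y phi -> sat y psi
  | Sub phi psi => exists y, [/\ mle M y x, sat y phi & ~ sat y psi]
  | Box i phi => forall y, mR M i x y -> sat y phi
  | Dia j phi => exists y, mS M j x y /\ sat y phi
  end.

Definition set_imp (n m : nat) (P : Type) (M : model n m P) (a b : set M) : set M :=
  [set x | forall y, mle M x y -> a y -> b y].

Definition set_sub (n m : nat) (P : Type) (M : model n m P) (a b : set M) : set M :=
  [set x | exists y, [/\ mle M y x, a y & ~ b y]].

Definition set_box (n m : nat) (P : Type) (M : model n m P) (i : 'I_n)
  (a : set M) : set M := [set x | rimage (mR M i) x `<=` a].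

Definition set_dia (n m : nat) (P : Type) (M : model n m P) (j : 'I_m)
  (a : set M) : set M := [set x | exists y, a y /\ mS M j x y].

Record admissible (n m : nat) (P : Type) (M : model n m P)
    (A : set (set M)) : Prop := Admissible {
  adm_upset : forall a, A a -> is_upset (mle M) a;
  adm0 : A set0;
  admT : A setT;
  admV : forall p, A (mV M p);
  admU : forall a b, A a -> A b -> A (a `|` b);
  admI : forall a b, A a -> A b -> A (a `&` b);
  adm_imp : forall a b, A a -> A b -> A (set_imp a b);
  adm_sub : forall a b, A a -> A b -> A (set_sub a b);
  adm_box : forall i a, A a -> A (set_box i a);
  adm_dia : forall j a, A a -> A (set_dia j a)
}.

(* A copy of X carrying the topology generated by the subbase D. *)
Definition subbase_space (X : Type) (D : set (set X)) : Type := X.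

HB.instance Definition _ (X : Type) (D : set (set X)) :=
  gen_eqMixin (subbase_space D).
HB.instance Definition _ (X : Type) (D : set (set X)) :=
  gen_choiceMixin (subbase_space D).
HB.instance Definition _ (X : Type) (D : set (set X)) :=
  isSubBaseTopological.Build (subbase_space D) D id.

Definition patch_subbase (X : Type) (A : set (set X)) : set (set X) :=
  A `|` [set ~` a | a in A].

Definition compact_for (X : Type) (A : set (set X)) (K : set X) : Prop :=
  cover_compact (K : set (subbase_space (patch_subbase A))).

Definition image_compact (n m : nat) (P : Type) (M : model n m P)
    (Z : M -> M -> Prop) : Prop :=
  exists A : set (set M), admissible A /\ forall x, compact_for A (rimage Z x).

Definition preimage_compact (n m : nat) (P : Type) (M : model n m P)
    (Z : M -> M -> Prop) : Prop :=
  exists A : set (set M), admissible A /\ forall x, compact_for A (rpreimage Z x).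

Definition forth_back (X X' : Type) (B : X -> X' -> Prop)
    (Z : X -> X -> Prop) (Z' : X' -> X' -> Prop) (x : X) (x' : X') : Prop :=
  (forall y, Z x y -> exists y', Z' x' y' /\ B y y') /\
  (forall y', Z' x' y' -> exists y, Z x y /\ B y y').

Record bisimulation (n m : nat) (P : Type) (M M' : model n m P)
    (B : M -> M' -> Prop) : Prop := Bisimulation {
  bis_V : forall x x', B x x' -> forall p, mV M p x <-> mV M' p x';
  bis_le : forall x x', B x x' -> forth_back B (mle M) (mle M') x x';
  bis_ge : forall x x', B x x' -> forth_back B (rinv (mle M)) (rinv (mle M')) x x';
  bis_R : forall x x', B x x' -> forall i, forth_back B (mR M i) (mR M' i) x x';
  bis_S : forall x x', B x x' -> forall j, forth_back B (mS M j) (mS M' j) x x'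
}.

Definition bisimilar (n m : nat) (P : Type) (M M' : model n m P)
    (x : M) (x' : M') : Prop :=
  exists B : M -> M' -> Prop, bisimulation B /\ B x x'.

(* Main.v *)
Require Import Defs.
From mathcomp Require Import all_boot.
From mathcomp Require Import finmap all_classical topology.

(** A Hennessy-Milner argument: logical equivalence is itself a bisimulation.
    If [y] is a [Z]-successor of [x] that is equivalent to no [Z']-successor of
    [x'], compactness of [Z'[x']] yields formulas [psi], [phi] such that
    [psi] holds and [phi] fails at [y], while [psi] implies [phi] at every
    successor of [x'].  For the preorder and its converse this contradicts
    equivalence at [psi -> phi] and [psi -< phi]; for [R_i] and [S_j] it does so
    at [Box_i (psi -> phi)] and [Dia_j (psi -< phi)], because strict
    condensation makes [R_i[x]] an upset and [S_j[x]] a downset. *)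

Set Implicit Arguments.
Unset Strict Implicit.
Unset Printing Implicit Defensive.

Local Open Scope classical_set_scope.

Section Bisimilarity.
Variables (n m : nat) (P : Type).
Implicit Types (M N : model n m P) (phi psi : formula n m P).

Definition logeq M N (x : M) (y : N) : Prop := forall phi, sat x phi <-> sat y phi.

Lemma logeq_sym M N (x : M) (y : N) : logeq x y -> logeq y x.
Proof. by move=> xy phi; split=> /xy. Qed.

Lemma bisimulation_sat M N (B : M -> N -> Prop) (x : M) (y : N) phi :
  bisimulation B -> B x y -> sat x phi <-> sat y phi.
Proof.
move=> bB; elim: phi x y => [||p|f IHf g IHg|f IHf g IHg|f IHf g IHg
  |f IHf g IHg|i f IHf|j f IHf] x y xy //=.
- exact: (bis_V bB xy).
- by rewrite (IHf _ _ xy) (IHg _ _ xy).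
- by rewrite (IHf _ _ xy) (IHg _ _ xy).
(* Universal connectives such as [Imp] and [Box] pass from [M] to [N] by the back condition; the
   existential [Sub] and [Dia] do so by the forth condition. *)
- have [forth back] := bis_le bB xy; split=> fg.
  + by move=> v /back[u [xu uv]] /(IHf _ _ uv) /(fg _ xu) /(IHg _ _ uv).
  + by move=> u /forth[v [yv uv]] /(IHf _ _ uv) /(fg _ yv) /(IHg _ _ uv).
- have [forth back] := bis_ge bB xy; split.
  + move=> [u [/forth[v [vy uv]] fu gu]]; exists v; split=> //.
    * exact/(IHf _ _ uv).
    * by move/(IHg _ _ uv).
  + move=> [v [/back[u [ux uv]] fv gv]]; exists u; split=> //.
    * exact/(IHf _ _ uv).
    * by move/(IHg _ _ uv).
- have [forth back] := bis_R bB xy i; split=> bf.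
  + by move=> v /back[u [xu uv]]; apply/(IHf _ _ uv)/bf.
  + by move=> u /forth[v [yv uv]]; apply/(IHf _ _ uv)/bf.
- have [forth back] := bis_S bB xy j; split.
  + by move=> [u [/forth[v [yv uv]] /(IHf _ _ uv) fv]]; exists v.
  + by move=> [v [/back[u [xu uv]] /(IHf _ _ uv) fu]]; exists u.
Qed.

(** The closure conditions mirror the connectives. Hence truth sets and their complements are
    subbasic open for whichever family [A] witnesses compactness. *)
Lemma admissible_sat M (A : set (set M)) phi :
  admissible A -> A [set x | sat x phi].
Proof.
move=> adA; elim: phi => [||p|f Af g Ag|f Af g Ag|f Af g Ag|f Af g Ag
  |i f Af|j f Af].
- exact: admT adA.
- exact: adm0 adA.
- exact: admV adA p.
- exact: admI adA _ _ Af Ag.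
- exact: admU adA _ _ Af Ag.
- exact: adm_imp adA _ _ Af Ag.
- exact: adm_sub adA _ _ Af Ag.
- exact: adm_box adA i _ Af.
(* [set_dia] lists its two conjuncts in the opposite order to [sat], so the sets are equal but not
   convertible. *)
- rewrite (_ : [set x | _] = set_dia j [set x | sat x f]).
    exact: adm_dia adA j _ Af.
  by apply/seteqP; split=> x [y []]; exists y.
Qed.

Lemma patch_subbase_open (X : Type) (A : set (set X)) (U : set X) :
  patch_subbase A U -> open (U : set (subbase_space (patch_subbase A))).
Proof.
move=> AU; exists [set U]; last by rewrite bigcup_set1.
move=> _ ->; exists [fset U]%fset; last by rewrite set_fset1 bigcap_set1.
by move=> _ /fset1P ->; apply/mem_set.
Qed.

(** Each point of [K] differs from [y] on some formula. A finite subcover leaves finitely many of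
    these: [psi] is the conjunction of those true at [y], [phi] the disjunction of those false at
    [y]. Two formulas occur because the complement of a truth set need not be a truth set. *)
Lemma compact_separation M N (A : set (set N)) (K : set N) (y : M) :
  admissible A -> compact_for A K -> (forall z, K z -> ~ logeq y z) ->
  exists psi phi, [/\ sat y psi, ~ sat y phi &
    forall z, K z -> sat z psi -> sat z phi].
Proof.
move=> adA cK yK.
(* These are the patch-open sets given by a formula whose value on them is opposite to its value at
   [y]. *)
pose D : set (set N) := [set U |
  (exists2 f, ~ sat y f & U = [set z | sat z f]) \/
  (exists2 f, sat y f & U = ~` [set z | sat z f])].
have openD U : D U -> open (U : set (subbase_space (patch_subbase A))).
  move=> DU; apply: patch_subbase_open; case: DU => -[f _ ->].
    by left; exact: admissible_sat.
  by right; exists [set z | sat z f] => //; exact: admissible_sat.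
have coverD : K `<=` cover D id.
  move=> z /yK /existsNP[f yzf]; have [yf|yf] := pselect (sat y f).
    by exists (~` [set z | sat z f]) => /=; [right; exists f|move=> zf; apply: yzf].
  exists [set z | sat z f] => /=; first by left; exists f.
  by apply: contrapT => zf; apply: yzf.
have [F FD KF] := cK _ D id openD coverD.
(* Stating the implication on each member of the subcover, not on [K], allows induction on the list
   of members. *)
suff [psi [phi [ypsi yphi imp]]] : exists psi phi, [/\ sat y psi, ~ sat y phi &
    forall U, U \in enum_fset F -> forall z, U z -> sat z psi -> sat z phi].
  by exists psi, phi; split=> // z /KF[U FU Uz]; exact: imp Uz.
have {KF}: forall U, U \in enum_fset F -> D U by move=> U /FD /set_mem.
elim: (enum_fset F) => [|U s IHs] sD.
  by exists (Top n m P), (Bot n m P); split=> //= ?.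
have [|psi [phi [ypsi yphi imp]]] := IHs.
  by move=> W sW; apply: sD; rewrite in_cons sW orbT.
case: (sD U (mem_head _ _)) => -[f yf Uf].
- exists psi, (Or f phi); split=> //=; first by case.
  move=> W; rewrite in_cons => /orP[/eqP ->|sW] z Wz psiz.
    by left; move: Wz; rewrite Uf.
  by right; exact: imp Wz psiz.
- exists (And f psi), phi; split=> //=.
  move=> W; rewrite in_cons => /orP[/eqP ->|sW] z Wz [fz psiz].
    by move: Wz; rewrite Uf.
  exact: imp Wz psiz.
Qed.

(** Contrapositive of the separation, with [K] and [L] as successor sets. The third hypothesis
    isolates what each relation must supply through its own modality. *)
Lemma logeq_forth M N (A : set (set N)) (K : set M) (L : set N) :
  admissible A -> compact_for A L ->
  (forall psi phi, (forall z, L z -> sat z psi -> sat z phi) ->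
    forall y, K y -> sat y psi -> sat y phi) ->
  forall y, K y -> exists z, L z /\ logeq y z.
Proof.
move=> adA cL LK y Ky; apply: contrapT => yL.
have [|psi [phi [ypsi yphi Limp]]] := @compact_separation _ _ _ _ y adA cL.
  by move=> z Lz yz; apply: yL; exists z.
exact/yphi/(LK _ _ Limp).
Qed.

Lemma logeq_forth_le M N (x : M) (x' : N) : image_compact (mle N) ->
  logeq x x' -> forall y, mle M x y -> exists y', mle N x' y' /\ logeq y y'.
Proof.
move=> [A [adA cA]] xx'; apply: (logeq_forth adA (cA x')) => psi phi.
by move/(xx' (Imp psi phi)).
Qed.

Lemma logeq_forth_ge M N (x : M) (x' : N) : preimage_compact (mle N) ->
  logeq x x' -> forall y, mle M y x -> exists y', mle N y' x' /\ logeq y y'.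
Proof.
move=> [A [adA cA]] xx'.
apply: (@logeq_forth _ _ _ [set y | mle M y x] _ adA (cA x')).
move=> psi phi imp y yx ypsi; apply: contrapT => yphi.
have /(xx' (Defs.Sub psi phi))[z [zx' zpsi]] : sat x (Defs.Sub psi phi) by exists y.
by apply; exact: imp.
Qed.

Lemma logeq_forth_R M N (x : M) (x' : N) i : strictly_condensed N ->
  image_compact (mR N i) -> logeq x x' ->
  forall y, mR M i x y -> exists y', mR N i x' y' /\ logeq y y'.
Proof.
move=> [cR _] [A [adA cA]] xx'; apply: (logeq_forth adA (cA x')) => psi phi imp.
have /(xx' (Box i (Imp psi phi))) xbox : sat x' (Box i (Imp psi phi)).
  (* Condensation is applied to the chain from [x'] to itself by [mle], to [y] by [mR], and up to
     [z]. *)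
  move=> y x'y z yz; apply: imp; apply: cR; exists y; split=> //.
  by exists x'; split=> //; exact: mle_refl.
by move=> y /xbox; apply; exact: mle_refl.
Qed.

Lemma logeq_forth_S M N (x : M) (x' : N) j : strictly_condensed N ->
  image_compact (mS N j) -> logeq x x' ->
  forall y, mS M j x y -> exists y', mS N j x' y' /\ logeq y y'.
Proof.
move=> [_ cS] [A [adA cA]] xx'; apply: (logeq_forth adA (cA x')) => psi phi imp.
move=> y xy ypsi; apply: contrapT => yphi.
have /(xx' (Dia j (Defs.Sub psi phi)))[z [x'z [w [wz wpsi]]]] :
    sat x (Dia j (Defs.Sub psi phi)).
  by exists y; split=> //; exists y; split=> //; exact: mle_refl.
(* Dually, [w] lies below the [mS]-successor [z] of [x'], hence is itself such a successor. *)
apply; apply: imp => //; apply: cS; exists z; split=> //.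
by exists x'; split=> //; exact: mle_refl.
Qed.

(** The back premise is phrased with [logeq y' y] so that the forth lemmas prove it with the two
    models exchanged. *)
Lemma forth_back_logeq M N (Z : M -> M -> Prop) (Z' : N -> N -> Prop)
    (x : M) (x' : N) :
  (forall y, Z x y -> exists y', Z' x' y' /\ logeq y y') ->
  (forall y', Z' x' y' -> exists y, Z x y /\ logeq y' y) ->
  forth_back (@logeq M N) Z Z' x x'.
Proof.
move=> forth back; split=> // y' /back[y [xy /logeq_sym yy']].
by exists y.
Qed.

End Bisimilarity.

Theorem theorem5p15 (n m : nat) (P : Type) (M M' : model n m P)
  (hM : strictly_condensed M) (hM' : strictly_condensed M')
  (hle : image_compact (mle M))
  (hR : forall i : 'I_n, image_compact (mR M i))
  (hS : forall j : 'I_m, image_compact (mS M j))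
  (hle' : image_compact (mle M'))
  (hR' : forall i : 'I_n, image_compact (mR M' i))
  (hS' : forall j : 'I_m, image_compact (mS M' j))
  (hge : preimage_compact (mle M))
  (hge' : preimage_compact (mle M')) :
  forall (x : M) (x' : M'),
    bisimilar x x' <-> (forall phi : formula n m P, sat x phi <-> sat x' phi).
Proof.
move=> x x'; split; first by move=> [B [bB xx']] phi; exact: bisimulation_sat bB xx'.
move=> xx'; exists (@logeq n m P M M'); split=> //.
split=> {xx'} {}x {}x' xx'; have x'x := logeq_sym xx'.
- by move=> p; exact: (xx' (Var n m p)).
- by apply: forth_back_logeq; exact: logeq_forth_le.
- by apply: forth_back_logeq; exact: logeq_forth_ge.
- by move=> i; apply: forth_back_logeq; exact: logeq_forth_R.
- by move=> j; apply: forth_back_logeq; exact: logeq_forth_S.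
Qed.
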